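(* For any projection algebra $P$, the free regular $*$-semigroup $\mathsf{PG}(P)$ has the semigroup presentation $$\mathsf{PG}(P)\cong\langle X_E:R_E'\rangle,$$ where $X_E=\{x_e:e\in E\}$ is an alphabet in one-one correspondence with $E=\mathbf E(P)$, and where $R_E'$ is the set of relations $$x_ex_f=x_{ef}\ \text{ for all }(e,f)\in\mathrm{BP}(E),$$ $$x_ex_f=x_ex_gx_f\ \text{ for all }e,f\in E\text{ and }g\in\mathsf S(e,f),$$ $$x_px_q=x_{pq}\ \text{ for all }p,q\in P\text{ with }p\mathrel{\mathscr F}q.$$
   Context: Maps are written to the right of their arguments and composed left to right. For a set $X$ and $R\subseteq X^+\times X^+$ (with $X^+$ the free semigroup on $X$), $\langle X:R\rangle$ denotes the semigroup $X^+/R^\sharp$, where $R^\sharp$ is the congruence on $X^+$ generated by $R$; a pair $(u,v)\in R$ is written $u=v$. A projection algebra is a set $P$ with unary operations $\theta_p:P\to P$ ($p\in P$) such that for all $p,q\in P$: $p\theta_p=p$; $\theta_p\theta_p=\theta_p$; $p\theta_q\theta_p=q\theta_p$; $\theta_p\theta_q\theta_p=\theta_{q\theta_p}$; $\theta_p\theta_q\theta_p\theta_q=\theta_p\theta_q$. On $P$ define $p\leq_{\mathscr F}q$ iff $p=q\theta_p$; $p\mathrel{\mathscr F}q$ iff $p\leq_{\mathscr F}q$ and $q\leq_{\mathscr F}p$. A $P$-path is a tuple $(p_1,\ldots,p_k)$ ($k\geq1$) with $p_1\mathrel{\mathscr F}\cdots\mathrel{\mathscr F}p_k$, regarded as a morphism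 $p_1\to p_k$; the path category $\mathscr P(P)$ consists of all $P$-paths under $(p_1,\ldots,p_k)\circ(p_k,\ldots,p_l)=(p_1,\ldots,p_k,\ldots,p_l)$, with identities $(p)$. A pair $(e,f)\in P\times P$ is $p$-linked ($p\in P$) if $f=e\theta_p\theta_f$ and $e=f\theta_p\theta_e$. Let $\equiv$ be the (category) congruence on $\mathscr P(P)$ generated by all pairs $((p,p),(p))$ with $p\in P$, all $((p,q,p),(p))$ with $p\mathrel{\mathscr F}q$, and all $((e,e\theta_p,f),(e,f\theta_p,f))$ with $p\in P$ and $(e,f)$ $p$-linked. The class of $(p_1,\ldots,p_k)$ is denoted $[\![p_1,\ldots,p_k]\!]$. The free (projection-generated) regular $*$-semigroup $\mathsf{PG}(P)$ consists of all these classes, with $[\![p_1,\ldots,p_k]\!]^*=[\![p_k,\ldots,p_1]\!]$ and product $[\![p_1,\ldots,p_k]\!]\cdot[\![q_1,\ldots,q_l]\!]=[\![p_1',\ldots,p_k',q_1',\ldots,q_l']\!]$, where, with $p'=q_1\theta_{p_k}$ and $q'=p_k\theta_{q_1}$, $p_i'=p'\theta_{p_k}\cdots\theta_{p_i}$ and $q_j'=q'\theta_{q_1}\cdots\theta_{q_j}$. The product of $\mathsf{PG}(P)$ is denoted here by juxtaposition. $E=\mathbf E(P)=\{[\![p,q]\!]:p\mathrel{\mathscr F}q\}$ is the set of all idempotents of $\mathsf{PG}(P)$, and $P\subseteq E$ via the identification $p=[\![p]\!]$. The set of basic pairs is $\mathrm{BP}(E)=\{(e,f)\in E\times E:\{e,f\}\cap\{ef,fe\}\neq\varnothing\}$;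 then $ef\in E$ for $(e,f)\in\mathrm{BP}(E)$. For $p\mathrel{\mathscr F}q$ in $P$, $pq=[\![p,q]\!]\in E$. For $e,f\in E$, the sandwich set is $\mathsf S(e,f)=\{g\in\mathsf M(e,f):h\preceq g\text{ for all }h\in\mathsf M(e,f)\}$, where $\mathsf M(e,f)=\{g\in E:ge=g=fg\}$ and $h\preceq g$ iff $eh=(eg)(eh)$ and $hf=(hf)(gf)$; equivalently, $\mathsf S(e,f)=\{g\in E:egf=ef\text{ and }fge=g\text{ in }\mathsf{PG}(P)\}$. *)

(* Defs.v *)
From HB Require Import structures.
From mathcomp Require Import all_boot.
From mathcomp Require Import boolp classical_sets.

Set Implicit Arguments.
Unset Strict Implicit.
Unset Printing Implicit Defensive.

Local Open Scope quotient_scope.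
Local Open Scope group_scope.
Local Open Scope classical_set_scope.

(* [theta p q] is q theta_p, so that x theta_p theta_q, with maps written to  *)
(* the right of their arguments, is [x \th_ p \th_ q].                        *)
HB.mixin Record isProjectionAlgebra P := {
  theta : P -> P -> P;
  theta_id : forall p, theta p p = p;
  theta_idem : forall p x, theta p (theta p x) = theta p x;
  theta_swap : forall p q, theta p (theta q p) = theta p q;
  theta_conj : forall p q x,
    theta p (theta q (theta p x)) = theta (theta p q) x;
  theta_stab : forall p q x,
    theta q (theta p (theta q (theta p x))) = theta q (theta p x)
}.

#[short(type="projAlgType")]
HB.structure Definition ProjectionAlgebra := {P of isProjectionAlgebra P}.

Notation "x \th_ p" := (theta p x)
  (at level 40, p at level 8, left associativity, format "x  \th_ p").

Section ProjectionAlgebraTheory.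
Variable P : projAlgType.
Implicit Types p q e f x y : P.

Definition leF p q : Prop := p = q \th_ p.
Definition eqF p q : Prop := leF p q /\ leF q p.

Definition linked p e f : Prop := f = e \th_ p \th_ f /\ e = f \th_ p \th_ e.

Lemma eqF_refl p : eqF p p.
Proof. by split; rewrite /leF theta_id. Qed.

Lemma eqF_sym p q : eqF p q -> eqF q p.
Proof. by case. Qed.

Lemma linked_sym p e f : linked p e f -> linked p f e.
Proof. by case. Qed.

Lemma linked_eqF1 p e f : linked p e f -> eqF e (e \th_ p).
Proof.
case=> hf he; split; rewrite /leF.
- by have := theta_stab p e f; rewrite -he.
- by rewrite -theta_conj !theta_swap.
Qed.

Lemma linked_eqF2 p e f : linked p e f -> eqF (e \th_ p) f.
Proof.
by case=> hf he; split; rewrite /leF // -theta_conj -he.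
Qed.

Lemma eqF_theta p q x : eqF p q -> eqF (x \th_ p) (x \th_ p \th_ q).
Proof.
case=> hp hq; split; rewrite /leF.
- by rewrite theta_swap -theta_conj -hp theta_swap.
- by rewrite -theta_conj !theta_swap.
Qed.

Lemma eqF_cross p q : eqF (q \th_ p) (p \th_ q).
Proof.
split; rewrite /leF -theta_conj.
- by rewrite theta_stab theta_swap.
- by rewrite theta_stab theta_swap.
Qed.

Lemma eqF_back p q x : eqF p q -> x \th_ p \th_ q \th_ p = x \th_ p.
Proof. by case=> hp _; rewrite theta_conj -hp. Qed.

Lemma linked_theta p e f x (y := x \th_ e) (g := y \th_ p \th_ f) :
  linked p e f ->
  [/\ linked p y g, y \th_ (e \th_ p) = y \th_ p,
      y \th_ (f \th_ p) = g \th_ p & g \th_ f = g].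
Proof.
case=> hf he.
have ye : y \th_ e = y by rewrite /y theta_idem.
have ey : forall z, z \th_ e \th_ y = z \th_ y.
  by move=> z; rewrite /y -!theta_conj theta_idem.
have key : y \th_ p \th_ f \th_ p \th_ e = y.
  by rewrite -{1}ye theta_conj theta_conj -he.
clearbody y; rewrite {}/g; split.
- split.
  + by rewrite -2!theta_conj -[_ \th_ y]ey key theta_id.
  + by rewrite -ey key theta_id.
- by rewrite -theta_conj -{1}ye theta_stab ye.
- by rewrite -theta_conj.
- by rewrite theta_idem.
Qed.

End ProjectionAlgebraTheory.

Section Paths.
Variable P : projAlgType.
Implicit Types p q e f x : P.

Definition eqFb p q : bool := `[< eqF p q >].

(* The P-path (p_1, ..., p_k) is stored as p_1 and the list [p_2; ...; p_k].  *)
Record ppath := PPath {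
  psource : P;
  ptail : seq P;
  _ : path eqFb psource ptail
}.

Definition ptarget (a : ppath) : P := last (psource a) (ptail a).

Lemma ppathP (a : ppath) : path eqFb (psource a) (ptail a).
Proof. by case: a. Qed.

Lemma ppath_eq (a b : ppath) :
  psource a = psource b -> ptail a = ptail b -> a = b.
Proof.
case: a b => [p s hs] [q t ht] /= epq est; subst q t.
by rewrite (bool_irrelevance hs ht).
Qed.

Lemma path1_proof p : path eqFb p [::].
Proof. by []. Qed.

Lemma path2_proof p q (h : eqF p q) : path eqFb p [:: q].
Proof. by rewrite /= andbT; apply/asboolP. Qed.

Lemma path3_proof p q r (h : eqF p q) (h' : eqF q r) : path eqFb p [:: q; r].
Proof. by apply/and3P; split=> //; apply/asboolP. Qed.

Definition path1 p : ppath := PPath (path1_proof p).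
Definition path2 p q (h : eqF p q) : ppath := PPath (path2_proof h).
Definition path3 p q r (h : eqF p q) (h' : eqF q r) : ppath :=
  PPath (path3_proof h h').

Lemma pcomp_proof (a b : ppath) (h : ptarget a = psource b) :
  path eqFb (psource a) (ptail a ++ ptail b).
Proof. by rewrite cat_path ppathP -/(ptarget a) h ppathP. Qed.

Definition pcomp (a b : ppath) (h : ptarget a = psource b) : ppath :=
  PPath (pcomp_proof h).

Inductive pgen : ppath -> ppath -> Prop :=
| pgen_id p : pgen (path2 (eqF_refl p)) (path1 p)
| pgen_back p q (h : eqF p q) : pgen (path3 h (eqF_sym h)) (path1 p)
| pgen_linked p e f (l : linked p e f) (l' := linked_sym l) :
    pgen (path3 (linked_eqF1 l) (linked_eqF2 l))
         (path3 (eqF_sym (linked_eqF2 l')) (eqF_sym (linked_eqF1 l'))).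

(* Both this relation and [pgen] only relate paths with the same ends, see    *)
(* [pequiv_ends].                                                             *)
Inductive pequiv : ppath -> ppath -> Prop :=
| pequiv_gen a b : pgen a b -> pequiv a b
| pequiv_refl a : pequiv a a
| pequiv_sym a b : pequiv a b -> pequiv b a
| pequiv_trans b a c : pequiv a b -> pequiv b c -> pequiv a c
| pequiv_comp a a' b b'
    (h : ptarget a = psource b) (h' : ptarget a' = psource b') :
    pequiv a a' -> pequiv b b' -> pequiv (pcomp h) (pcomp h').

Lemma pequiv_ends a b :
  pequiv a b -> psource a = psource b /\ ptarget a = ptarget b.
Proof.
elim=> {a b} //.
- by move=> a b [].
- by move=> a b _ [].
- by move=> b a c _ [-> ->].
- move=> a a' b b' h h' _ [sa ta] _ [sb tb]; split=> //=.
  by rewrite /ptarget /= !last_cat -!/(ptarget _) h h'.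
Qed.

Lemma prev_proof a :
  path eqFb (ptarget a) (rev (belast (psource a) (ptail a))).
Proof.
rewrite /ptarget rev_path -(eq_path (e := eqFb)) ?ppathP // => p q.
by apply/asboolP/asboolP; apply: eqF_sym.
Qed.

(* (p_k, ..., p_1)                                                            *)
Definition prev a : ppath := PPath (prev_proof a).

Lemma prestr_proof x a :
  path eqFb (x \th_ (psource a))
    (scanl (fun y q => y \th_ q) (x \th_ (psource a)) (ptail a)).
Proof.
case: a => p s /= hs; elim: s p x hs => [//|q s IHs] p x /= /andP[/asboolP hpq hs].
apply/andP; split; first by apply/asboolP/eqF_theta.
exact: IHs hs.
Qed.

(* (q_1', ..., q_l') with q_j' = x theta_(q_1) ... theta_(q_j)                *)
Definition prestr x a : ppath := PPath (prestr_proof x a).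

(* (p_1', ..., p_k') with p_i' = x theta_(p_k) ... theta_(p_i)                *)
Definition pcorestr a x : ppath := prev (prestr x (prev a)).

Lemma psource_prev a : psource (prev a) = ptarget a.
Proof. by []. Qed.

Lemma ptarget_prev a : ptarget (prev a) = psource a.
Proof.
rewrite /ptarget /= /ptarget; case: a => p [|q s] //= _.
by rewrite rev_cons last_rcons.
Qed.

Lemma ptarget_pcorestr a x : ptarget (pcorestr a x) = x \th_ (ptarget a).
Proof. by rewrite ptarget_prev. Qed.

Lemma pmul_proof a b
    (a' := pcorestr a (psource b \th_ (ptarget a)))
    (b' := prestr (ptarget a \th_ (psource b)) b) :
  path eqFb (psource a') (ptail a' ++ psource b' :: ptail b').
Proof.
rewrite cat_path ppathP /= -/(ptarget a') ptarget_pcorestr.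
apply/andP; split; last exact: (ppathP b').
by apply/asboolP; rewrite !theta_idem; apply: eqF_cross.
Qed.

(* (p_1', ..., p_k', q_1', ..., q_l')                                         *)
Definition pmul a b : ppath := PPath (pmul_proof a b).

Lemma pmul_val a b :
  psource (pmul a b) :: ptail (pmul a b) =
  rev (scanl (fun y p => y \th_ p) (psource b \th_ (ptarget a))
         (rev (psource a :: ptail a)))
  ++ scanl (fun y q => y \th_ q) (ptarget a \th_ (psource b))
       (psource b :: ptail b).
Proof.
rewrite (lastI (psource a)) rev_rcons [RHS]/=.
by rewrite [_ :: scanl _ _ (rev _)]lastI rev_rcons.
Qed.

Lemma pequiv_prestr x a b : pequiv a b -> pequiv (prestr x a) (prestr x b).
Proof.
move=> eab; elim: eab x => {a b}.
- move=> _ _ [p|p q h|p e f l l'] x.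
  + have -> : prestr x (path2 (eqF_refl p)) = path2 (eqF_refl (x \th_ p)).
      by apply: ppath_eq; rewrite //= theta_idem.
    have -> : prestr x (path1 p) = path1 (x \th_ p) by apply: ppath_eq.
    exact/pequiv_gen/pgen_id.
  + have h' := eqF_theta x h.
    have -> : prestr x (path3 h (eqF_sym h)) = path3 h' (eqF_sym h').
      by apply: ppath_eq; rewrite //= eqF_back.
    have -> : prestr x (path1 p) = path1 (x \th_ p) by apply: ppath_eq.
    exact/pequiv_gen/pgen_back.
  + have [lyg e1 e2 e3] := linked_theta x l.
    have := pequiv_gen (pgen_linked lyg).
    set u := path3 _ _; set v := path3 _ _.
    set a := path3 _ _; set b := path3 _ _.
    have -> : prestr x a = u.
      by apply: ppath_eq; rewrite //= !e1.
    have -> // : prestr x b = v.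
    by apply: ppath_eq; rewrite //= !e2 theta_stab.
- by move=> a x; apply: pequiv_refl.
- by move=> a b _ IH x; apply: pequiv_sym.
- by move=> b a c _ IH _ IH' x; apply: pequiv_trans (IH x) (IH' x).
- move=> a a' b b' h h' _ IH _ IH' x.
  have comp (c d : ppath) (k : ptarget c = psource d) :
      exists k', prestr x (pcomp k)
                 = @pcomp (prestr x c) (prestr (ptarget (prestr x c)) d) k'.
    have k' : ptarget (prestr x c)
              = psource (prestr (ptarget (prestr x c)) d).
      rewrite /= -k /ptarget /=; move: (psource c) (ptail c) => p s.
      elim/last_ind: s => [|s q _]; first by rewrite /= theta_idem.
      by rewrite scanl_rcons !last_rcons -cats1 foldl_cat /= theta_idem.
    exists k'; apply: ppath_eq => //=.
    rewrite scanl_cat; congr (_ ++ _).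
    have -> : foldl (fun y q => y \th_ q) (x \th_ (psource c)) (ptail c)
              = ptarget (prestr x c).
      rewrite /ptarget /=; move: (_ \th_ _) (ptail c) => y s.
      by elim: s y => //= q s IHs y.
    by congr (scanl _ _ _); exact: k'.
  have [k ->] := comp _ _ h; have [k' ->] := comp _ _ h'.
  apply: pequiv_comp; first exact: IH.
  by have [_ <-] := pequiv_ends (IH x); apply: IH'.
Qed.

Lemma pequiv_prev a b : pequiv a b -> pequiv (prev a) (prev b).
Proof.
elim=> {a b}.
- move=> _ _ [p|p q h|p e f l l'].
  + have -> : prev (path2 (eqF_refl p)) = path2 (eqF_refl p) by apply: ppath_eq.
    have -> : prev (path1 p) = path1 p by apply: ppath_eq.
    exact/pequiv_gen/pgen_id.
  + have -> : prev (path3 h (eqF_sym h)) = path3 h (eqF_sym h).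
      exact: ppath_eq.
    have -> : prev (path1 p) = path1 p by apply: ppath_eq.
    exact/pequiv_gen/pgen_back.
  + have := pequiv_sym (pequiv_gen (pgen_linked l')).
    set u := path3 _ _; set v := path3 _ _.
    set a := path3 _ _; set b := path3 _ _.
    have -> : prev a = u by apply: ppath_eq.
    by have -> : prev b = v by apply: ppath_eq.
- by move=> a; apply: pequiv_refl.
- by move=> a b _; apply: pequiv_sym.
- by move=> b a c _ ab _; apply: pequiv_trans.
- move=> a a' b b' h h' _ IH _ IH'.
  have comp (c d : ppath) (k : ptarget c = psource d) :
      exists k', prev (pcomp k) = @pcomp (prev d) (prev c) k'.
    have k' : ptarget (prev d) = psource (prev c) by rewrite ptarget_prev.
    exists k'; apply: ppath_eq => /=.
      by rewrite /ptarget /= last_cat -!/(ptarget _) k.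
    by rewrite belast_cat rev_cat -/(ptarget c) k.
  have [k ->] := comp _ _ h; have [k' ->] := comp _ _ h'.
  exact: pequiv_comp.
Qed.

Lemma pequiv_mul a a' b b' :
  pequiv a a' -> pequiv b b' -> pequiv (pmul a b) (pmul a' b').
Proof.
move=> ea eb.
have [sb _] := pequiv_ends eb; have [_ ta] := pequiv_ends ea.
have mulE p q (h : eqF p q) c d :
    p = psource d \th_ (ptarget c) -> q = ptarget c \th_ (psource d) ->
    exists k k', pmul c d =
      @pcomp (@pcomp (pcorestr c p) (path2 h) k) (prestr q d) k'.
  move=> ep eq.
  have k : ptarget (pcorestr c p) = psource (path2 h).
    by rewrite ptarget_pcorestr /= ep theta_idem.
  have k' : ptarget (pcomp k) = psource (prestr q d).
    by rewrite /ptarget /= last_cat /= eq theta_idem.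
  exists k, k'; apply: ppath_eq; rewrite /= -?ep //.
  by rewrite -catA /= eq theta_idem.
have h := eqF_cross (ptarget a) (psource b).
have [k [k' ->]] := mulE _ _ h a b erefl erefl.
have [l [l' ->]] := mulE _ _ h a' b' (congr2 _ ta sb) (congr2 _ sb ta).
apply: pequiv_comp; last exact: pequiv_prestr.
apply: pequiv_comp; last exact: pequiv_refl.
exact/pequiv_prev/pequiv_prestr/pequiv_prev.
Qed.

End Paths.
HB.instance Definition _ (P : projAlgType) := gen_eqMixin (ppath P).
HB.instance Definition _ (P : projAlgType) := gen_choiceMixin (ppath P).

Section FreeRegularStarSemigroup.
Variable P : projAlgType.
Implicit Types p q : P.

Definition pequivb (a b : ppath P) : bool := `[< pequiv a b >].

Lemma pequivb_refl : reflexive pequivb.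
Proof. by move=> a; apply/asboolP; apply: pequiv_refl. Qed.

Lemma pequivb_sym : symmetric pequivb.
Proof. by move=> a b; apply/asboolP/asboolP; apply: pequiv_sym. Qed.

Lemma pequivb_trans : transitive pequivb.
Proof.
move=> b a c /asboolP ab /asboolP bc; apply/asboolP.
exact: pequiv_trans ab bc.
Qed.

Canonical pequivb_equiv := EquivRel pequivb pequivb_refl pequivb_sym
                                    pequivb_trans.

Definition PG := {eq_quot pequivb}.
HB.instance Definition _ := EqQuotient.on PG.
HB.instance Definition _ := Choice.on PG.

Lemma PG_eqP (a b : ppath P) : \pi_PG a = \pi_PG b <-> pequiv a b.
Proof.
split=> [/eqP|ab]; last by apply/eqP; rewrite piE; apply/asboolP.
by rewrite piE => /asboolP.
Qed.

Definition pg_mul : PG -> PG -> PG := lift_op2 PG (@pmul P).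

Lemma pi_pg_mul : {morph \pi_PG : a b / pmul a b >-> pg_mul a b}.
Proof.
move=> a b; rewrite /pg_mul -lock; apply/PG_eqP/pequiv_mul; apply/PG_eqP.
  by rewrite reprK.
by rewrite reprK.
Qed.
Canonical pi_pg_mul_morph := PiMorph2 pi_pg_mul.

HB.instance Definition _ := hasMul.Build PG pg_mul.

Lemma PG_mulE (a b : ppath P) : \pi_PG a * \pi_PG b = \pi_PG (pmul a b).
Proof. by rewrite pi_pg_mul. Qed.

Definition cls1 p : PG := \pi_PG (path1 p).
Definition cls2 p q (h : eqF p q) : PG := \pi_PG (path2 h).

Definition idemE : set PG :=
  [set x | exists p q (h : eqF p q), x = cls2 h].

Definition basic_pair (e f : PG) : Prop :=
  [/\ idemE e, idemE f & [set e; f] `&` [set e * f; f * e] !=set0].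

Definition sandM (e f : PG) : set PG :=
  [set g | [/\ idemE g, g * e = g & g = f * g]].

(* h \preceq g, as a relation on [sandM e f]                                  *)
Definition sand_le (e f h g : PG) : Prop :=
  e * h = (e * g) * (e * h) /\ h * f = (h * f) * (g * f).

Definition sandwich (e f : PG) : set PG :=
  [set g | sandM e f g /\ forall h, sandM e f h -> sand_le e f h g].

Lemma idemE_cls2 p q (h : eqF p q) : cls2 h \in idemE.
Proof. by apply/mem_set; exists p, q, h. Qed.

Lemma cls2_refl p : cls2 (eqF_refl p) = cls1 p.
Proof. exact/PG_eqP/pequiv_gen/pgen_id. Qed.

Lemma idemE_cls1 p : cls1 p \in idemE.
Proof. by rewrite -cls2_refl; apply: idemE_cls2. Qed.

Lemma cls1_mul p q (h : eqF p q) : cls1 p * cls1 q = cls2 h.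
Proof.
rewrite /cls1 /cls2 PG_mulE; congr (\pi_PG _).
case: h => hp hq.
by apply: ppath_eq; rewrite /= /ptarget /= theta_idem -?hp -?hq.
Qed.

Definition letterE (e : PG) (he : e \in idemE) : idemE := exist _ e he.

End FreeRegularStarSemigroup.

Record fsemigroup (X : Type) := FSemigroup {
  fsval :> seq X;
  _ : ~~ nilp fsval
}.

HB.instance Definition _ (X : Type) := gen_eqMixin (fsemigroup X).
HB.instance Definition _ (X : Type) := gen_choiceMixin (fsemigroup X).

Section FreeSemigroup.
Variable X : Type.

Lemma fsval_inj : injective (@fsval X).
Proof.
move=> [u hu] [v hv] /= uv; subst v.
by rewrite (bool_irrelevance hu hv).
Qed.

Lemma fs_mul_proof (u v : fsemigroup X) : ~~ nilp (u ++ v).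
Proof. by case: u => -[|x u]. Qed.

Definition fs_mul (u v : fsemigroup X) : fsemigroup X :=
  FSemigroup (fs_mul_proof u v).

Lemma fs_mulA : associative fs_mul.
Proof. by move=> u v w; apply: fsval_inj; rewrite /= catA. Qed.

HB.instance Definition _ := isSemigroup.Build (fsemigroup X) fs_mulA.

Lemma fsgen_proof (x : X) : ~~ nilp [:: x].
Proof. by []. Qed.

Definition fsgen (x : X) : fsemigroup X := FSemigroup (fsgen_proof x).

End FreeSemigroup.

Notation "\x_ e" := (fsgen e) (at level 8, e at level 2, format "\x_ e").

Inductive congr_gen (S : magmaType) (R : S -> S -> Prop) : S -> S -> Prop :=
| congr_gen_rel u v : R u v -> congr_gen R u v
| congr_gen_refl u : congr_gen R u u
| congr_gen_sym u v : congr_gen R u v -> congr_gen R v u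
| congr_gen_trans v u w :
    congr_gen R u v -> congr_gen R v w -> congr_gen R u w
| congr_gen_mul u u' v v' :
    congr_gen R u u' -> congr_gen R v v' -> congr_gen R (u * v) (u' * v').

Section Presentation.
Variables (X : Type) (R : fsemigroup X -> fsemigroup X -> Prop).

Definition sharp (u v : fsemigroup X) : bool := `[< congr_gen R u v >].

Lemma sharp_refl : reflexive sharp.
Proof. by move=> u; apply/asboolP; apply: congr_gen_refl. Qed.

Lemma sharp_sym : symmetric sharp.
Proof. by move=> u v; apply/asboolP/asboolP; apply: congr_gen_sym. Qed.

Lemma sharp_trans : transitive sharp.
Proof.
move=> v u w /asboolP uv /asboolP vw; apply/asboolP.
exact: congr_gen_trans uv vw.
Qed.

Canonical sharp_equiv := EquivRel sharp sharp_refl sharp_sym sharp_trans.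

(* <X : R>                                                                    *)
Definition presentation := {eq_quot sharp}.
HB.instance Definition _ := EqQuotient.on presentation.
HB.instance Definition _ := Choice.on presentation.

Lemma presentation_eqP (u v : fsemigroup X) :
  \pi_presentation u = \pi_presentation v <-> congr_gen R u v.
Proof.
split=> [/eqP|uv]; last by apply/eqP; rewrite piE; apply/asboolP.
by rewrite piE => /asboolP.
Qed.

Definition pres_mul : presentation -> presentation -> presentation :=
  lift_op2 presentation (@fs_mul X).

Lemma pi_pres_mul :
  {morph \pi_presentation : u v / fs_mul u v >-> pres_mul u v}.
Proof.
move=> u v; rewrite /pres_mul -lock.
apply/presentation_eqP/congr_gen_mul; apply/presentation_eqP.
  by rewrite reprK.
by rewrite reprK.
Qed.
Canonical pi_pres_mul_morph := PiMorph2 pi_pres_mul.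

Lemma pres_mulA : associative pres_mul.
Proof.
by elim/quotW=> u; elim/quotW=> v; elim/quotW=> w; rewrite !piE fs_mulA.
Qed.

HB.instance Definition _ := isSemigroup.Build presentation pres_mulA.

End Presentation.

Definition semigroup_isom (S T : magmaType) : Prop :=
  exists f : {multiplicative S -> T}, bijective f.

Section Relations.
Variable P : projAlgType.

Local Notation X_E := (@idemE P).
Local Notation proj p := (letterE (idemE_cls1 p)).
Local Notation prod2 h := (letterE (idemE_cls2 h)).

(* The alphabet is E itself. In [RE'_basic], [ef] is the element of E whose   *)
(* value is the product of e and f in PG(P).                                  *)
Inductive RE' : fsemigroup X_E -> fsemigroup X_E -> Prop :=
| RE'_basic (e f ef : X_E) :
    basic_pair (val e) (val f) -> val ef = val e * val f ->
    RE' (\x_e * \x_f) \x_ef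
| RE'_sandwich (e f g : X_E) :
    sandwich (val e) (val f) (val g) ->
    RE' (\x_e * \x_f) (\x_e * \x_g * \x_f)
| RE'_proj (p q : P) (h : eqF p q) :
    RE' (\x_(proj p) * \x_(proj q)) \x_(prod2 h).

End Relations.

(* Main.v *)
From HB Require Import structures.
From mathcomp Require Import all_boot.
From mathcomp Require Import boolp classical_sets.
Require Import Defs.

(** PG(P) is generated by the projections [p], and everything rests on three
    relations between them: p p = p, p q p = q theta_p and
    (p q) (p q) = p q. They are the hypotheses of [proj_family].

    A family x_p of elements of any semigroup that satisfies these relations
    can be multiplied along paths. The product along (p_1, ..., p_k) depends
    only on the class of the path ([pprod_pequiv]), because for a p-linked
    pair (e, f) the relations turn both x_e x_(e theta_p) x_f and
    x_e x_(f theta_p) x_f into x_e x_p x_f; and it carries the product of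
    PG(P) to the product of the semigroup ([pprod_mul]), because
    x_p x_q = x_(q theta_p) x_(p theta_q). Three such families occur.

    - Left multiplication by a projection has a simple description on paths,
      [pmul1E]. The relations hold for these maps of PG(P) to itself: the only
      serious point is that q (p b) and q ((q theta_p) b) are the two sides of
      one linked-pair relation ([pmul2_linked]). As composition of maps is
      associative, so is the product of PG(P) ([pg_mulA]).
    - The projections of PG(P) themselves then satisfy the relations
      ([cls1_family]), and the product of their classes along a path is the
      class of that path.
    - So do the letters x_p in the presented semigroup ([genp_family]). Here
      the sandwich relations come in: g = q p lies in S(p, q), and both (p, g)
      and (g, q) are basic pairs, with p g = q theta_p and g q = p theta_q, so
      that x_p x_q = x_p x_g x_q reduces to x_(q theta_p) x_q and to
      x_p x_(p theta_q).

    The last point gives a homomorphism from PG(P) to the presented semigroup.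
    Its inverse evaluates words in PG(P). That this respects the sandwich
    relations amounts to e f = e g f for g in S(e, f) ([sandwich_mul]). *)

Set Implicit Arguments.
Unset Strict Implicit.
Unset Printing Implicit Defensive.

Local Open Scope quotient_scope.
Local Open Scope group_scope.

(** * Projection algebras *)

Section Theta.
Variable P : projAlgType.
Implicit Types p q r : P.

Lemma eqFl p q : eqF p q -> q \th_ p = p.
Proof. by case=> h _; symmetry. Qed.

Lemma eqFr p q : eqF p q -> p \th_ q = q.
Proof. by case=> _ h; symmetry. Qed.

Lemma theta_sub p q : p \th_ (q \th_ p) = q \th_ p.
Proof. by rewrite -theta_conj theta_id theta_swap. Qed.

Lemma eqF_below p q z : eqF p q -> q \th_ (z \th_ p) = z \th_ p.
Proof. by move=> /eqFl e; rewrite -theta_conj e theta_swap. Qed.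

(** Suppose that a path starts at r. Multiplying it on the left by p and then
    by q makes it start at f, and the vertex r itself becomes t; see [pmul2E].
    The vertex of q (p b) between f and t is t theta_p, and that of
    q ((q theta_p) b) is f theta_p, which is why this linked pair relates the
    two. *)
Lemma linked_theta2 p q r (u := q \th_ p) (f := r \th_ p \th_ q) :
  linked p (u \th_ r) f.
Proof.
have e1 : u \th_ r \th_ p = q \th_ (r \th_ p) by rewrite theta_conj.
have e2 : f \th_ p = r \th_ u by rewrite theta_conj.
split; first by rewrite e1; symmetry; apply: eqFl; apply: eqF_cross.
by rewrite e2; symmetry; apply: eqFl; apply: eqF_cross.
Qed.

End Theta.

(** * Paths built by adding a vertex in front *)

Section PathExtension.
Variable P : projAlgType.
Implicit Types (p q e f x y : P) (a b c : ppath P).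

Lemma pcons_proof p b (h : eqF p (psource b)) :
  path (@eqFb P) p (psource b :: ptail b).
Proof. by rewrite /= ppathP andbT; apply/asboolP. Qed.

Definition pcons p b (h : eqF p (psource b)) : ppath P :=
  PPath (pcons_proof h).

Lemma ppath_ind (K : ppath P -> Prop) :
    (forall p, K (path1 p)) ->
    (forall p b (h : eqF p (psource b)), K b -> K (pcons h)) ->
  forall a, K a.
Proof.
move=> K1 Kc [p s hs]; elim: s p hs => [|q s IH] p hs.
  by rewrite (_ : PPath hs = path1 p) //; apply: ppath_eq.
have /andP[/asboolP hpq hs'] := hs.
have -> : PPath hs = @pcons p (PPath hs') hpq by apply: ppath_eq.
exact/Kc/IH.
Qed.

(** A congruence step at the beginning of a path, with the composites given by
    their vertices, which avoids dependent casts. *)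
Lemma pequiv_extend a a' b c c' :
    pequiv a a' -> ptarget a = psource b ->
    psource c :: ptail c = psource a :: ptail a ++ ptail b ->
    psource c' :: ptail c' = psource a' :: ptail a' ++ ptail b ->
  pequiv c c'.
Proof.
move=> ea h [sc tc] [sc' tc'].
have h' : ptarget a' = psource b by have [_ <-] := pequiv_ends ea.
rewrite (_ : c = pcomp h); last exact: ppath_eq.
rewrite (_ : c' = pcomp h'); last exact: ppath_eq.
by apply: pequiv_comp => //; apply: pequiv_refl.
Qed.

Lemma pequiv_cons_id p b (h : eqF p (psource b)) :
  p = psource b -> pequiv (pcons h) b.
Proof.
move=> e; apply: (pequiv_extend (b := b) (pequiv_gen (pgen_id p))) => //=;
  by rewrite e.
Qed.

Lemma pequiv_cons_back p q b (h : eqF q (psource b))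
    (h' : eqF p (psource (pcons h))) :
  p = psource b -> pequiv (pcons h') b.
Proof.
move=> e; apply: (pequiv_extend (b := b) (pequiv_gen (pgen_back h'))) => //=;
  by rewrite e.
Qed.

Lemma pequiv_cons_linked p e b x y
    (hx : eqF x (psource b)) (hy : eqF y (psource b))
    (hx' : eqF e (psource (pcons hx))) (hy' : eqF e (psource (pcons hy))) :
  linked p e (psource b) -> x = e \th_ p -> y = psource b \th_ p ->
  pequiv (pcons hx') (pcons hy').
Proof.
move=> l ex ey.
by apply: (pequiv_extend (b := b) (pequiv_gen (pgen_linked l)));
  rewrite //= ?ex ?ey.
Qed.

(** * Left multiplication by a projection *)

(** Restriction is transitive: restricting the restriction of a path to x
    further, to some y below x, is the same as restricting the path to y. *)
Lemma scanl_theta x y (s : seq P) :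
  y \th_ x = y ->
  scanl (fun z q => z \th_ q) y (scanl (fun z q => z \th_ q) x s)
  = scanl (fun z q => z \th_ q) y s.
Proof.
elim: s x y => //= q s IH x y yx.
have e : y \th_ (x \th_ q) = y \th_ q.
  by rewrite -theta_conj -{1}yx theta_stab yx.
by rewrite e IH // -theta_conj theta_idem -{1}yx theta_stab yx.
Qed.

Lemma prestr_source b : prestr (psource b) b = b.
Proof.
apply: ppath_eq; rewrite /= theta_id //.
have := ppathP b; elim: (ptail b) (psource b) => //= q s IH p.
case/andP=> /asboolP h hs.
by rewrite (eqFr h) IH.
Qed.

Lemma pmul1_proof p b :
  eqF ((psource b) \th_ p) (psource (prestr (p \th_ (psource b)) b)).
Proof. by rewrite /= theta_idem; apply: eqF_cross. Qed.

Lemma pmul1E p b : pmul (path1 p) b = pcons (pmul1_proof p b).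
Proof. by apply: ppath_eq; rewrite /= /ptarget /= ?theta_idem. Qed.

(** When the source t of the path satisfies t <=_F p, the vertex p theta_t to
    which the path has to be restricted is t itself. *)
Lemma pmul1_below p b (h : eqF ((psource b) \th_ p) (psource b)) :
  p \th_ (psource b) = psource b -> pmul (path1 p) b = pcons h.
Proof.
move=> e; rewrite pmul1E.
by apply: ppath_eq; rewrite //= e -[in RHS](prestr_source b).
Qed.

(** In the natural order, where t <= q means t = t theta_q, the restricted path
    starts below the source of the original path. *)
Lemma psource_pcorestr a z :
  exists w, psource (pcorestr a z) = w \th_ (psource a).
Proof.
elim/ppath_ind: a => [p|p b h _]; first by eexists; rewrite /= /ptarget /=.
rewrite /= /ptarget /= rev_cons scanl_rcons last_rcons.
by eexists; rewrite -cats1 foldl_cat /=.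
Qed.

(** The vertex p contributes only a projection factor: the source t of a b is
    below that of a by [psource_pcorestr], so that t <=_F p by [eqF_below], and
    [pmul1_below] applies. This reduces products of paths to left
    multiplications by projections. *)
Lemma pmul_cons p a b (h : eqF p (psource a)) :
  pmul (pcons h) b = pmul (path1 p) (pmul a b).
Proof.
set z := psource b \th_ (ptarget a).
have E : psource (pcorestr (pcons h) z) :: ptail (pcorestr (pcons h) z)
  = psource (pcorestr a z) \th_ p
    :: psource (pcorestr a z) :: ptail (pcorestr a z).
  have tE : ptarget (pcons h) = ptarget a by [].
  rewrite /= /ptarget /= rev_cons scanl_rcons last_rcons belast_rcons.
  rewrite tE -[X in _ = _ :: X]rev_rcons -lastI -cats1 foldl_cat /=.
  congr (_ \th_ _ :: _).
  by elim: (rev _) (z \th_ _) => //= q s IH y.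
have [w ew] := psource_pcorestr a z.
have e : p \th_ (psource (pmul a b)) = psource (pmul a b).
  by rewrite [psource (pmul a b)]ew eqF_below //; apply: eqF_sym.
have k : eqF (psource (pmul a b) \th_ p) (psource (pmul a b)).
  by rewrite -{2}e; apply: eqF_cross.
rewrite (pmul1_below k e); case: E => E1 E2.
apply: ppath_eq; first exact: E1.
by rewrite [RHS]/= -/(ptail (pcorestr a z)) -cat_cons -[_ :: _]E2.
Qed.

Lemma pmul_idem p b :
  pequiv (pmul (path1 p) (pmul (path1 p) b)) (pmul (path1 p) b).
Proof.
have s1 : psource (pmul (path1 p) b) = psource b \th_ p by rewrite pmul1E.
have e1 : psource (pmul (path1 p) b) \th_ p = psource (pmul (path1 p) b).
  by rewrite s1 theta_idem.
have k : eqF (psource (pmul (path1 p) b) \th_ p) (psource (pmul (path1 p) b)).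
  by rewrite e1; apply: eqF_refl.
rewrite (pmul1_below k); first exact: pequiv_cons_id.
by rewrite s1 theta_sub.
Qed.

Lemma pmul2E q p b (t := q \th_ p \th_ (psource b))
    (h : eqF (q \th_ (psource b \th_ p)) (psource (prestr t b)))
    (h' : eqF (psource b \th_ p \th_ q) (psource (pcons h))) :
  pmul (path1 q) (pmul (path1 p) b) = pcons h'.
Proof.
have e1 : q \th_ (psource b \th_ p) \th_ (p \th_ (psource b)) = t.
  by rewrite -!theta_conj !theta_stab.
have e2 : t \th_ (p \th_ (psource b)) = t.
  by rewrite -theta_conj theta_idem theta_stab.
rewrite !pmul1E; apply: ppath_eq; rewrite //= !theta_idem.
by rewrite e1 scanl_theta.
Qed.

(** The paths q (p b) and f :: u b, with u = q theta_p, differ only in their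
    second vertex, and the pair [linked_theta2] makes them equivalent. The
    second of them contains u b, which is what makes the relations for p q p
    and (q p) (q p) visible below. *)
Lemma pmul2_linked q p b (u := q \th_ p) (t := u \th_ (psource b))
    (f := psource b \th_ p \th_ q) :
  exists (h1 : eqF (q \th_ (psource b \th_ p)) (psource (prestr t b)))
    (h2 : eqF (psource b \th_ u) (psource (prestr t b)))
    (h1' : eqF f (psource (pcons h1))) (h2' : eqF f (psource (pcons h2))),
  [/\ pmul (path1 q) (pmul (path1 p) b) = pcons h1',
      pmul (path1 u) b = pcons h2 & pequiv (pcons h1') (pcons h2')].
Proof.
have st : psource (prestr t b) = t by rewrite /= theta_idem.
have l : linked p t f by apply: linked_theta2.
have e1 : t \th_ p = q \th_ (psource b \th_ p) by rewrite -theta_conj.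
have e2 : f \th_ p = psource b \th_ u by rewrite -theta_conj.
have h1 : eqF (q \th_ (psource b \th_ p)) (psource (prestr t b)).
  by rewrite st -e1; apply/eqF_sym/(linked_eqF1 l).
have h2 : eqF (psource b \th_ u) (psource (prestr t b)).
  by rewrite st -e2; apply: (linked_eqF2 (linked_sym l)).
have h1' : eqF f (psource (pcons h1)).
  by rewrite /= -e1; apply/eqF_sym/(linked_eqF2 l).
have h2' : eqF f (psource (pcons h2)).
  by rewrite /= -e2; apply: (linked_eqF1 (linked_sym l)).
exists h1, h2, h1', h2'; split; first exact: pmul2E.
  by rewrite pmul1E; apply: ppath_eq.
apply/pequiv_sym/(pequiv_cons_linked (p := p)); rewrite ?st //.
exact: linked_sym.
Qed.

Lemma pmul_conj q p b :
  pequiv (pmul (path1 p) (pmul (path1 q) (pmul (path1 p) b)))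
         (pmul (path1 (q \th_ p)) b).
Proof.
have [h1 [h2 [h1' [h2' [-> -> e]]]]] := pmul2_linked q p b.
apply: pequiv_trans (pequiv_mul (pequiv_refl _) e) _.
(* The leftmost factor p adds f theta_p in front, which is already the vertex
   that follows f: the path goes back and forth. *)
have k : eqF (psource (pcons h2') \th_ p) (psource (pcons h2')).
  by rewrite /= theta_conj; apply: eqF_sym.
rewrite (pmul1_below k).
  by apply: pequiv_cons_back; rewrite /= theta_conj.
by rewrite /= -2!theta_conj theta_swap theta_conj theta_swap.
Qed.

Lemma pmul_stab q p b :
  pequiv (pmul (path1 q) (pmul (path1 p) (pmul (path1 q) (pmul (path1 p) b))))
         (pmul (path1 q) (pmul (path1 p) b)).
Proof.
apply: pequiv_trans (pequiv_mul (pequiv_refl _) (pmul_conj q p b)) _.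
have [h1 [h2 [h1' [h2' [-> _ e]]]]] := pmul2_linked q p b.
(* The product of q and u b is the path f :: u b itself. *)
rewrite (_ : pmul _ _ = pcons h2'); first exact: pequiv_sym.
have qu : q \th_ (q \th_ p) = q \th_ p by rewrite -theta_conj !theta_swap.
set r := psource b in h1 h2 h1' h2' e *; set u := q \th_ p in qu h2 h2' e *.
have e3 : r \th_ u \th_ q = r \th_ p \th_ q by rewrite -theta_conj theta_stab.
have [k1 [_ [k1' [_ [-> _ _]]]]] := pmul2_linked q u b.
have e4 : q \th_ (r \th_ u) = r \th_ u by rewrite -theta_conj qu theta_swap.
by apply: ppath_eq; rewrite /= -?/r ?e3 ?e4 ?qu.
Qed.

End PathExtension.

(** * Products along paths *)

Fixpoint rprod (S : magmaType) (X : Type) (x : X -> S) (i : X) (s : seq X) :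
    S :=
  if s is j :: s' then x i * rprod x j s' else x i.

Section Products.
Variable P : projAlgType.
Implicit Types (p q : P) (a b : ppath P).

(** The abstract form of the relations between the projections of PG(P), stated
    for any family indexed by P so as to cover maps and letters as well. *)
Definition proj_family (S : magmaType) (x : P -> S) : Prop :=
  [/\ forall p, x p * x p = x p,
      forall p q, x p * x q * x p = x (q \th_ p) &
      forall p q, x p * x q * (x p * x q) = x p * x q].

Definition pprod (S : magmaType) (x : P -> S) a : S :=
  rprod x (psource a) (ptail a).

Lemma pprod1 (S : magmaType) (x : P -> S) p : pprod x (path1 p) = x p.
Proof. by []. Qed.

Lemma pprod_cons (S : magmaType) (x : P -> S) p a (h : eqF p (psource a)) :
  pprod x (pcons h) = x p * pprod x a.
Proof. by []. Qed.

Section Family.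
Variables (S : semigroupType) (x : P -> S).
Hypothesis xP : proj_family x.

Lemma family_id p : x p * x p = x p. Proof. by case: xP. Qed.

Lemma family_conj p q : x p * x q * x p = x (q \th_ p).
Proof. by case: xP. Qed.

Lemma family_stab p q : x p * x q * (x p * x q) = x p * x q.
Proof. by case: xP. Qed.

Lemma family_left p q : x p * x q = x (q \th_ p) * x q.
Proof. by rewrite -family_conj -mulgA family_stab. Qed.

Lemma family_right p q : x p * x q = x p * x (p \th_ q).
Proof. by rewrite -family_conj !mulgA -[RHS]mulgA family_stab. Qed.

Lemma pprod_source a : x (psource a) * pprod x a = pprod x a.
Proof.
elim/ppath_ind: a => [p|p a h _]; first by rewrite pprod1 family_id.
by rewrite pprod_cons mulgA family_id.
Qed.

Lemma pprod_comp a b (h : ptarget a = psource b) :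
  pprod x (pcomp h) = pprod x a * pprod x b.
Proof.
elim/ppath_ind: a b h => [p|p a k IH] b h.
  rewrite (_ : pcomp h = b); last exact: ppath_eq.
  by rewrite pprod1 [p]h pprod_source.
have k' : eqF p (psource (@pcomp _ a b h)) by [].
rewrite (_ : pcomp h = pcons k'); last exact: ppath_eq.
by rewrite !pprod_cons IH mulgA.
Qed.

Lemma pprod_pequiv a b : pequiv a b -> pprod x a = pprod x b.
Proof.
elim=> {a b} //.
- move=> _ _ [p|p q h|p e f l l'].
  + exact: family_id.
  + by rewrite /pprod /= mulgA family_conj (eqFl h).
  + by rewrite /pprod /= -(family_left p f) !mulgA -(family_right e p).
- by move=> b a c _ -> _ ->.
- by move=> a a' b b' h h' _ ea _ eb; rewrite !pprod_comp ea eb.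
Qed.

(** Under a prefix x_y, each factor x_q can be replaced by x_(z theta_q), where
    z is the vertex reached so far; this moves the restriction of a path in or
    out of a product. *)
Lemma pprod_prestr y b : x y * pprod x b = x y * pprod x (prestr y b).
Proof.
elim/ppath_ind: b y => [p|p b h IH] y; first exact: family_right.
rewrite pprod_cons mulgA family_right.
have h' : eqF (y \th_ p) (psource (prestr (y \th_ p) b)) by apply: eqF_theta.
rewrite (_ : prestr y (pcons h) = pcons h'); last exact: ppath_eq.
by rewrite -mulgA IH pprod_cons.
Qed.

Lemma pprod_mul1 p b : pprod x (pmul (path1 p) b) = x p * pprod x b.
Proof.
rewrite pmul1E pprod_cons -[in RHS](pprod_source b) mulgA family_left.
rewrite family_right theta_swap -mulgA [in RHS]pprod_prestr.
congr (_ * _).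
have e : psource (prestr (p \th_ (psource b)) b) = p \th_ (psource b).
  by rewrite /= theta_idem.
by have := pprod_source (prestr (p \th_ (psource b)) b); rewrite e.
Qed.

Lemma pprod_mul a b : pprod x (pmul a b) = pprod x a * pprod x b.
Proof.
elim/ppath_ind: a => [p|p a h IH]; first by rewrite pprod_mul1.
by rewrite pmul_cons pprod_mul1 IH mulgA.
Qed.

End Family.
End Products.

(** * Associativity of the product of PG(P) *)

(** A separate name, so that the semigroup structure is composition. *)
Definition selfmap (T : Type) := T -> T.
HB.instance Definition _ (T : Type) := gen_eqMixin (selfmap T).
HB.instance Definition _ (T : Type) := gen_choiceMixin (selfmap T).
Definition selfmap_comp (T : Type) (f g : selfmap T) : selfmap T :=
  fun t => f (g t).
Lemma selfmap_compA (T : Type) : associative (@selfmap_comp T).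
Proof. by []. Qed.
HB.instance Definition _ (T : Type) :=
  isSemigroup.Build (selfmap T) (@selfmap_compA T).

Lemma selfmapE (T : Type) (f g : selfmap T) z : (f * g) z = f (g z).
Proof. by []. Qed.

Section Associativity.
Variable P : projAlgType.
Implicit Types (p q : P) (a b c : ppath P).

Definition lmul (p : P) : selfmap (PG P) := fun z => cls1 p * z.

Lemma lmul_pi p b : lmul p (\pi_(PG P) b) = \pi_(PG P) (pmul (path1 p) b).
Proof. by rewrite /lmul PG_mulE. Qed.

Lemma lmul_family : proj_family lmul.
Proof.
split=> [p|p q|p q]; apply/funext; elim/quotW=> b;
  rewrite ?selfmapE !lmul_pi; apply/PG_eqP.
- exact: pmul_idem.
- exact: pmul_conj.
- exact: pmul_stab.
Qed.

Lemma pprod_lmul a z : pprod lmul a z = \pi_(PG P) a * z.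
Proof.
elim/quotW: z => c; elim/ppath_ind: a => [p|p a h IH] //.
by rewrite pprod_cons selfmapE IH !PG_mulE lmul_pi pmul_cons.
Qed.

(** By [pprod_lmul], left multiplication by the class of a path is a composite
    of maps [lmul p], and [pprod_mul] says that products of paths correspond to
    composites. *)
Lemma pg_mulA : associative (@mul (PG P)).
Proof.
elim/quotW=> a; elim/quotW=> b c.
by rewrite PG_mulE -!pprod_lmul (pprod_mul lmul_family) selfmapE.
Qed.

End Associativity.

HB.instance Definition _ (P : projAlgType) :=
  Magma_isSemigroup.Build (PG P) (@pg_mulA P).

(** * Projections and sandwich sets in PG(P) *)

Section Idempotents.
Variable P : projAlgType.
Implicit Types (p q : P) (a b c : ppath P).

Lemma cls1_cross p q : cls1 p * cls1 q = cls2 (eqF_cross p q).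
Proof.
rewrite PG_mulE; apply: (congr1 \pi_(PG P)).
by apply: ppath_eq; rewrite /= /ptarget /= theta_idem.
Qed.

Lemma cls1_id p : cls1 p * cls1 p = cls1 p.
Proof. by rewrite (cls1_mul (eqF_refl p)) cls2_refl. Qed.

Lemma cls1_cons p a (h : eqF p (psource a)) :
  cls1 p * \pi_(PG P) a = \pi_(PG P) (pcons h).
Proof.
have e := eqFr h; rewrite PG_mulE; apply: (congr1 \pi_(PG P)).
have k : eqF (psource a \th_ p) (psource a) by rewrite (eqFl h).
by rewrite (pmul1_below k) //; apply: ppath_eq; rewrite //= (eqFl h).
Qed.

Lemma pprod_cls1 a : pprod (@cls1 P) a = \pi_(PG P) a.
Proof.
elim/ppath_ind: a => [p|p a h IH] //.
by rewrite pprod_cons IH cls1_cons.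
Qed.

(** The relations for the maps [lmul p], evaluated at projections. *)
Lemma cls1_family : proj_family (@cls1 P).
Proof.
have [_ L2 L3] := lmul_family P.
split=> [|p q|p q]; first exact: cls1_id.
- have /(congr1 (fun f => f (cls1 p))) := L2 p q.
  rewrite !selfmapE /lmul cls1_id mulgA => ->.
  rewrite cls1_cross -cls2_refl; apply: (congr1 \pi_(PG P)).
  by apply: ppath_eq; rewrite //= ?theta_idem ?theta_sub.
- have /(congr1 (fun f => f (cls1 q))) := L3 p q.
  by rewrite !selfmapE /lmul cls1_id mulgA.
Qed.

(** For e = p q and f = r s, the idempotent g_0 = r q = f (e f)^* e belongs to
    M(e, f) and satisfies e g_0 f = e f. As g is at least g_0 in the sandwich
    preorder, e g_0 = (e g) (e g_0), whence
    e f = (e g) (e g_0) f = e g (e f) = e g f. *)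
Lemma sandwich_mul (e f g : PG P) :
  idemE e -> idemE f -> sandwich e f g -> e * f = e * g * f.
Proof.
move=> [p [q [h ->]]] [r [s [k ->]]] [[_ ge _] max_g].
have x2 := family_conj cls1_family; have x3 := family_stab cls1_family.
pose g0 : PG P := cls1 r * cls1 q.
have e_g0_f : cls2 h * g0 * cls2 k = cls2 h * cls2 k.
  rewrite -!cls1_mul /g0 -[in RHS]mulgA (mulgA (cls1 q)) -(x3 q r).
  by rewrite !mulgA.
have /max_g[e_g0 _] : sandM (cls2 h) (cls2 k) g0.
  split; first by rewrite /g0 cls1_cross; apply: set_mem; apply: idemE_cls2.
  - by rewrite /g0 -cls1_mul -mulgA (mulgA (cls1 q)) x2 (eqFr h).
  - by rewrite /g0 -cls1_mul mulgA x2 (eqFl k).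
by rewrite -{1}e_g0_f e_g0 -[LHS]mulgA e_g0_f -mulgA (mulgA g) ge mulgA.
Qed.

Lemma sandwich_cls1 p q :
  sandwich (cls1 p) (cls1 q) (cls1 q * cls1 p).
Proof.
have x1 := cls1_id; have x3 := family_stab cls1_family.
split.
  split; last by rewrite mulgA x1.
  - by rewrite cls1_cross; apply: set_mem; apply: idemE_cls2.
  - by rewrite -mulgA x1.
move=> h [_ hp qh]; split.
- rewrite qh !mulgA -[_ * cls1 p * cls1 p]mulgA x1.
  by rewrite -[X in _ = X * h]mulgA x3.
- rewrite -hp !mulgA -[_ * cls1 q * cls1 q]mulgA x1.
  by rewrite -!(mulgA h) -(mulgA (cls1 p * cls1 q)) x3.
Qed.

End Idempotents.

(** * The presented semigroup *)

Section Presentation.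
Variable P : projAlgType.
Implicit Types (p q : P) (e f g : @idemE P).
Local Notation Pres := (presentation (@RE' P)).

Definition gen e : Pres := \pi_Pres \x_e.
Definition projE p : @idemE P := letterE (idemE_cls1 p).
Definition genp p : Pres := gen (projE p).

Lemma pi_mul (u v : fsemigroup (@idemE P)) :
  \pi_Pres (u * v) = \pi_Pres u * \pi_Pres v.
Proof. exact: (pi_pres_mul (@RE' P)). Qed.

Lemma gen_basic e f g :
  basic_pair (val e) (val f) -> val g = val e * val f -> gen e * gen f = gen g.
Proof.
move=> b v; rewrite /gen -pi_mul; apply/presentation_eqP/congr_gen_rel.
exact: RE'_basic.
Qed.

Lemma gen_sandwich e f g :
  sandwich (val e) (val f) (val g) -> gen e * gen f = gen e * gen g * gen f.
Proof.
move=> b; rewrite /gen -!pi_mul; apply/presentation_eqP/congr_gen_rel.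
exact: RE'_sandwich.
Qed.

Lemma gen_proj p q (h : eqF p q) :
  genp p * genp q = gen (letterE (idemE_cls2 h)).
Proof.
rewrite /genp /gen -!pi_mul; apply/presentation_eqP/congr_gen_rel.
exact: RE'_proj.
Qed.

Lemma basic_pair_absorb e f :
  val f * val e = val e \/ val f * val e = val f -> basic_pair (val e) (val f).
Proof.
move=> h; split; [exact/set_mem/valP|exact/set_mem/valP|].
by case: h => h; [exists (val e)|exists (val f)]; split; rewrite /= ?h; auto.
Qed.

(** Once x_p x_q is known to equal both x_(q theta_p) x_q and
    x_p x_(p theta_q), one can replace p and q by the related projections
    p' = q theta_p and q' = p theta_q, whose product p' q' is a letter; then
    (p' q', p') is a basic pair with product p'. *)
Lemma genp_family : proj_family genp.
Proof.
have x1 := @cls1_id P; have x2 := family_conj (@cls1_family P).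
have genp_sandwich p q :
    genp p * genp q = genp (q \th_ p) * genp q /\
    genp p * genp q = genp p * genp (p \th_ q).
  pose g := letterE (idemE_cls2 (eqF_cross q p)).
  have gE : val g = cls1 q * cls1 p by rewrite cls1_cross.
  have pg : genp p * gen g = genp (q \th_ p).
    apply: (gen_basic (e := projE p) (g := projE _)); last
      by rewrite gE mulgA x2.
    by apply: basic_pair_absorb; right; rewrite gE -mulgA x1.
  have gq : gen g * genp q = genp (p \th_ q).
    apply: (gen_basic (f := projE q) (g := projE _)); last by rewrite gE x2.
    by apply: basic_pair_absorb; left; rewrite gE mulgA x1.
  have -> : genp p * genp q = genp p * gen g * genp q.
    apply: (gen_sandwich (e := projE p) (f := projE q)); rewrite gE.
    exact: sandwich_cls1.
  by rewrite {1}pg -mulgA gq.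
have genp_conj p q : genp p * genp q * genp p = genp (q \th_ p).
  have [-> _] := genp_sandwich p q.
  have [_ ->] := genp_sandwich (q \th_ p) q.
  rewrite theta_swap -mulgA.
  have [_ ->] := genp_sandwich (p \th_ q) p.
  rewrite theta_swap mulgA (gen_proj (eqF_cross p q)).
  have v : cls2 (eqF_cross p q) = cls1 (q \th_ p) * cls1 (p \th_ q).
    by rewrite (cls1_mul (eqF_cross p q)).
  apply: (gen_basic (f := projE _) (g := projE _)); last
    by rewrite /= v x2 (eqFl (eqF_cross p q)).
  by apply: basic_pair_absorb; left; rewrite /= v mulgA x1.
split=> // [p|p q].
- apply: (gen_basic (e := projE p) (f := projE p) (g := projE p)); last
    by rewrite /= x1.
  by apply: basic_pair_absorb; left; rewrite /= x1.
- by rewrite mulgA genp_conj; have [<-] := genp_sandwich p q.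
Qed.

(** * The isomorphism *)

Definition PG_to_pres (z : PG P) : Pres := pprod genp (repr z).

Lemma PG_to_pres_pi (a : ppath P) : PG_to_pres (\pi_(PG P) a) = pprod genp a.
Proof. by apply: (pprod_pequiv genp_family); apply/PG_eqP; rewrite reprK. Qed.

Lemma PG_to_pres_mul : {morph PG_to_pres : y z / y * z}.
Proof.
elim/quotW=> a; elim/quotW=> b.
by rewrite PG_mulE !PG_to_pres_pi (pprod_mul genp_family).
Qed.

Lemma PG_to_pres_val e : PG_to_pres (val e) = gen e.
Proof.
have [p [q [h eh]]] : idemE (val e) by exact/set_mem/valP.
rewrite (_ : e = letterE (idemE_cls2 h)); last exact: val_inj.
by rewrite -gen_proj [LHS]PG_to_pres_pi.
Qed.

Definition word_eval (u : fsemigroup (@idemE P)) : PG P :=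
  match u with
  | FSemigroup [::] h => False_rect _ (notF h)
  | FSemigroup (e :: s) _ => rprod val e s
  end.

Lemma word_ind (K : fsemigroup (@idemE P) -> Prop) :
    (forall e, K \x_e) -> (forall e u, K u -> K (\x_e * u)) ->
  forall u, K u.
Proof.
move=> K1 Kc [[|e s] hs] //; elim: s e hs => [|f s IH] e hs.
  by rewrite (_ : FSemigroup hs = \x_e) //; apply: fsval_inj.
have hs' : ~~ nilp (f :: s) by [].
rewrite (_ : FSemigroup hs = \x_e * FSemigroup hs'); first exact/Kc/IH.
exact: fsval_inj.
Qed.

Lemma word_eval_cons e u : word_eval (\x_e * u) = val e * word_eval u.
Proof. by case: u => -[]. Qed.

Lemma word_eval_mul u v : word_eval (u * v) = word_eval u * word_eval v.
Proof.
elim/word_ind: u => [e|e u IH]; first by rewrite word_eval_cons.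
by rewrite -mulgA !word_eval_cons IH mulgA.
Qed.

Lemma word_eval_congr u v : congr_gen (@RE' P) u v -> word_eval u = word_eval v.
Proof.
elim=> {u v} //.
- move=> _ _ [e f ef _ efE|e f g efg|p q h]; rewrite !word_eval_mul //=.
  + by apply: sandwich_mul efg; exact/set_mem/valP.
  + exact: cls1_mul.
- by move=> v u w _ -> _ ->.
- by move=> u u' v v' _ eu _ ev; rewrite !word_eval_mul eu ev.
Qed.

Definition pres_to_PG (w : Pres) : PG P := word_eval (repr w).

Lemma pres_to_PG_pi u : pres_to_PG (\pi_Pres u) = word_eval u.
Proof. by apply: word_eval_congr; apply/presentation_eqP; rewrite reprK. Qed.

Lemma pres_to_PG_mul : {morph pres_to_PG : v w / v * w}.
Proof.
by elim/quotW=> u; elim/quotW=> v; rewrite -pi_mul !pres_to_PG_pi word_eval_mul.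
Qed.

Lemma PG_to_presK : cancel PG_to_pres pres_to_PG.
Proof.
elim/quotW=> a; rewrite PG_to_pres_pi -pprod_cls1.
elim/ppath_ind: a => [p|p a h IH]; first by rewrite pprod1 pres_to_PG_pi.
by rewrite !pprod_cons pres_to_PG_mul IH pres_to_PG_pi.
Qed.

Lemma pres_to_PGK : cancel pres_to_PG PG_to_pres.
Proof.
elim/quotW=> u; rewrite pres_to_PG_pi; elim/word_ind: u => [e|e u IH].
  exact: PG_to_pres_val.
by rewrite word_eval_cons PG_to_pres_mul IH PG_to_pres_val pi_mul.
Qed.

End Presentation.

HB.instance Definition _ (P : projAlgType) :=
  isMultiplicative.Build (PG P) (presentation (@RE' P))
    (@PG_to_pres P) (@PG_to_pres_mul P).

Theorem theorem7p13 (P : projAlgType) :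
  semigroup_isom (PG P) (presentation (@RE' P)).
Proof.
exists (@PG_to_pres P); exists (@pres_to_PG P).
- exact: PG_to_presK.
- exact: pres_to_PGK.
Qed.
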